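(* Let $\mathcal{F}_0,\mathcal{F}_1$ be hereditary families of finite subsets of $\mathbb{N}$, each covering $\mathbb{N}$. Then $\mathcal{F}_0$ and $\mathcal{F}_1$ are geometrically dual if and only if there is a perfect graph $G$ on the vertex set $\mathbb{N}$ such that $\mathcal{F}_0$ is the family of all finite cliques of $G$ and $\mathcal{F}_1$ is the family of all finite anti-cliques of $G$.
   Context: $\mathbb{N}=\{1,2,\dots\}$. A family $\mathcal{F}$ is hereditary if $E\subseteq F\in\mathcal{F}$ implies $E\in\mathcal{F}$; it covers $\mathbb{N}$ if $\bigcup\mathcal{F}=\mathbb{N}$. For $x\in\mathbb{R}^{\mathbb{N}}$ let $\|x\|_{\mathcal{F}}=\sup\{\sum_{i\in F}|x(i)|:F\in\mathcal{F}\}\in[0,\infty]$, $Y_{\mathcal{F}}=\{x\in\mathbb{R}^{\mathbb{N}}:\|x\|_{\mathcal{F}}<\infty\}$, and $X_{\mathcal{F}}=\{x\in\mathbb{R}^{\mathbb{N}}:\|P_{[n,\infty)}(x)\|_{\mathcal{F}}\to 0\}$, where $P_A(x)$ agrees with $x$ on $A$ and is $0$ off $A$. With $\|\cdot\|_{\mathcal{F}}$ these are Banach spaces, and the unit vectors $(e_n)$ form a 1-unconditional basis of $X_{\mathcal{F}}$. The dual $X_{\mathcal{F}}^*$ is regarded as a subset of $\mathbb{R}^{\mathbb{N}}$ by identifying $\alpha\in X_{\mathcal{F}}^*$ with the sequence $(\alpha(e_n))_n$, and it carries its dual norm. $\mathcal{F}$ is the geometric dual of $\mathcal{H}$ if $Y_{\mathcal{F}}=X_{\mathcal{H}}^*$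 as subsets of $\mathbb{R}^{\mathbb{N}}$ with equal norms. $\mathcal{F}$ and $\mathcal{H}$ are geometrically dual if each is the geometric dual of the other. Graphs are simple and undirected. A clique is a set of pairwise adjacent vertices; an anti-clique is a set of pairwise non-adjacent vertices (the empty set and singletons are both). A graph $G=(V,E)$ is perfect if for every finite $H\subseteq V$ the induced subgraph $G\upharpoonright H$ has chromatic number equal to its clique number. *)

(* Defs.v *)
From HB Require Import structures.
From mathcomp Require Import all_boot all_order all_algebra finmap.
From mathcomp Require Import all_classical all_reals all_analysis.

Set Implicit Arguments.
Unset Strict Implicit.
Unset Printing Implicit Defensive.

Import Order.TTheory GRing.Theory Num.Theory.
Import numFieldNormedType.Exports.

Local Open Scope classical_set_scope.
Local Open Scope ring_scope.

(* The index set {1, 2, ...} is represented by nat through n |-> n - 1.       *)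

Record hcfamily := HCFamily {
  hcfam : set {fset nat};
  hcfam_hereditary : forall A B : {fset nat},
    (A `<=` B)%fset -> hcfam B -> hcfam A;
  hcfam_cover : forall n : nat, exists2 A, hcfam A & n \in A }.

Section Norm.
Context {R : realType} (F : hcfamily).
Implicit Types (x y : nat -> R) (A : {fset nat}).

Definition fnorm x : \bar R :=
  ereal_sup [set (\sum_(i <- A) `|x i|)%:E | A in hcfam F].

Definition Yset : set (nat -> R) := [set x | (fnorm x < +oo)%E].

(* x \_ A is the projection P_A x: the default value of patch in R is 0.      *)
Definition Xset : set (nat -> R) :=
  [set x | fnorm (x \_ [set i | (n <= i)%N]) @[n --> \oo] --> 0%E].

Lemma fnorm_ub x A : hcfam F A -> ((\sum_(i <- A) `|x i|)%:E <= fnorm x)%E.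
Proof. by move=> FA; apply: ereal_sup_ubound; exists A. Qed.

Lemma fnorm_le x (a : \bar R) :
  (forall A, hcfam F A -> ((\sum_(i <- A) `|x i|)%:E <= a)%E) -> (fnorm x <= a)%E.
Proof. by move=> h; apply: ge_ereal_sup => _ [A FA <-]; exact: h. Qed.

Lemma fnorm_ge0 x : (0 <= fnorm x)%E.
Proof.
have [A FA _] := hcfam_cover F 0; apply: le_trans (fnorm_ub x FA).
by rewrite lee_fin sumr_ge0.
Qed.

Lemma fnorm0 : fnorm 0 = 0%E.
Proof.
apply/eqP; rewrite eq_le fnorm_ge0 andbT; apply: fnorm_le => A _.
by rewrite big1// => i _; rewrite normr0.
Qed.

Lemma fnormD x y : (fnorm (x + y)%R <= fnorm x + fnorm y)%E.
Proof.
apply: fnorm_le => A FA; apply: le_trans (leeD (fnorm_ub x FA) (fnorm_ub y FA)).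
by rewrite -EFinD lee_fin -big_split; apply: ler_sum => i _; exact: ler_normD.
Qed.

Lemma fnormZ (a : R) x : fnorm (a *: x) = (`|a|%:E * fnorm x)%E.
Proof.
rewrite /fnorm -ereal_supZl//; last first.
  have [A FA _] := hcfam_cover F 0; apply/set0P.
  by exists (\sum_(i <- A) `|x i|)%:E; exists A.
rewrite image_comp; congr ereal_sup; apply: eq_imagel => A _ /=.
by rewrite -EFinM mulr_sumr; congr EFin; apply: eq_bigr => i _; rewrite normrM.
Qed.

Lemma fnorm_coord x i : (`|x i|%:E <= fnorm x)%E.
Proof.
have [A FA iA] := hcfam_cover F i.
apply: le_trans (fnorm_ub x FA); rewrite lee_fin.
rewrite (big_fsetD1 i)//= lerDl; exact: sumr_ge0.
Qed.

Lemma restrictE x (P : pred nat) i :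
  (x \_ [set j | P j]) i = if P i then x i else 0.
Proof.
rewrite patchE; have [Pi|/negP nPi] := boolP (P i).
  by rewrite mem_set.
by rewrite memNset.
Qed.

Lemma restrict_split x n :
  x = x \_ [set i | (i < n)%N] + x \_ [set i | (n <= i)%N].
Proof.
apply/funext => i; rewrite addrfctE !restrictE.
by case: ltnP => _; rewrite ?addr0 ?add0r.
Qed.

Lemma fnorm_single x n : (fnorm (x \_ [set n]) <= `|x n|%:E)%E.
Proof.
have h i : i != n -> `|(x \_ [set n]) i| = 0.
  by move=> /eqP ni; rewrite patchE memNset// normr0.
apply: fnorm_le => A _; rewrite lee_fin.
have [nA|nA] := boolP (n \in A).
  rewrite (big_fsetD1 n)//= patchE mem_set//= big_seq big1 ?addr0// => i.
  by rewrite !inE => /andP[+ _]; exact: h.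
rewrite big_seq big1// => i iA; apply: h.
by apply: contraNneq nA => <-.
Qed.

Lemma fnorm_head_fin x n : (fnorm (x \_ [set i | (i < n)%N]) < +oo)%E.
Proof.
elim: n => [|n IH].
  rewrite (_ : x \_ _ = 0) ?fnorm0//; apply/funext => i.
  by rewrite restrictE.
rewrite (_ : x \_ _ = x \_ [set i | (i < n)%N] + x \_ [set n]).
  apply: le_lt_trans (fnormD _ _) _; rewrite lte_add_pinfty//.
  by apply: le_lt_trans (fnorm_single _ _) _; rewrite ltry.
apply/funext => i; rewrite addrfctE !restrictE [in RHS]patchE ltnS.
case: ltngtP => [ni|ni|->]; last by rewrite mem_set// add0r.
- by rewrite memNset ?addr0//= => e; rewrite e ltnn in ni.
- by rewrite memNset ?addr0//= => e; rewrite e ltnn in ni.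
Qed.

Lemma Xset_fnorm_fin x : Xset x -> fnorm x \is a fin_num.
Proof.
move=> Xx; rewrite ge0_fin_numE ?fnorm_ge0//.
have [N _ /(_ N (leqnn N)) /= hN] : \forall n \near \oo,
    (fnorm (x \_ [set i | (n <= i)%N]) < 1)%E.
  exact: (Xx _ (open_ereal_lt' lte01)).
rewrite {1}(restrict_split x N); apply: le_lt_trans (fnormD _ _) _.
by rewrite lte_add_pinfty ?fnorm_head_fin// (lt_trans hN)// ltry.
Qed.

Lemma Xset_eventually0 x n : (forall i, (n <= i)%N -> x i = 0) -> Xset x.
Proof.
move=> x0; apply: cvg_near_cst; exists n => // m /= nm.
rewrite (_ : x \_ _ = 0) ?fnorm0//; apply/funext => i; rewrite restrictE.
by case: leqP => // mi; apply: x0; exact: leq_trans mi.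
Qed.

Lemma Xset_submod : submod_closed [pred x | x \in Xset].
Proof.
split=> [|a x y]; rewrite !inE; first exact: (@Xset_eventually0 0 0).
move=> Xx Xy; rewrite /Xset/=.
apply: (@squeeze_cvge _ _ _ _ (cst 0%E) _ (fun n =>
  `|a|%:E * fnorm (x \_ [set i | (n <= i)%N]) +
   fnorm (y \_ [set i | (n <= i)%N]))%E).
- near=> n; rewrite fnorm_ge0/= -fnormZ; apply: le_trans (fnormD _ _).
  rewrite le_eqVlt; apply/orP; left; apply/eqP; congr fnorm; apply/funext => i.
  transitivity (a * (x \_ [set i | (n <= i)%N]) i +
                (y \_ [set i | (n <= i)%N]) i); last by [].
  by rewrite !restrictE; case: ifP => _ //; rewrite mulr0 addr0.
- exact: cvg_cst.
- rewrite -[X in _ --> X]adde0 -{1}(mule0 `|a|%:E).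
  by apply: cvgeD => //; apply: cvgeZl.
Unshelve. all: by end_near. Qed.

End Norm.

Section Xspace.
Context (R : realType) (F : hcfamily).

Definition Xpred : {pred nat -> R} := [pred x | x \in Xset F].

Record Xspace := XSpace { Xval : nat -> R; Xval_in : Xval \in Xpred }.

HB.instance Definition _ := [isSub for Xval].
HB.instance Definition _ := [Choice of Xspace by <:].
HB.instance Definition _ := GRing.isSubmodClosed.Build _ _ Xpred
  (GRing.submod_closed_semi (@Xset_submod R F)).
HB.instance Definition _ := [SubChoice_isSubLmodule of Xspace by <:].

Implicit Types x y : Xspace.

Definition Xnorm x : R := fine (fnorm F (Xval x)).

Lemma XnormE x : (Xnorm x)%:E = fnorm F (Xval x).
Proof.
by rewrite fineK//; apply: Xset_fnorm_fin; have := Xval_in x; rewrite !inE.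
Qed.

Lemma Xval_inj : injective Xval. Proof. exact: val_inj. Qed.

Lemma ler_XnormD x y : Xnorm (x + y) <= Xnorm x + Xnorm y.
Proof. by rewrite -lee_fin EFinD !XnormE fnormD. Qed.

Lemma XnormZ (a : R) x : Xnorm (a *: x) = `|a| * Xnorm x.
Proof. by apply: EFin_inj; rewrite EFinM !XnormE fnormZ. Qed.

Lemma Xnorm_eq0 x : Xnorm x = 0 -> x = 0.
Proof.
move=> x0; apply: Xval_inj; apply/funext => i; apply/normr0_eq0/eqP.
rewrite eq_le normr_ge0 andbT -lee_fin.
by apply: le_trans (fnorm_coord F _ _) _; rewrite -XnormE x0.
Qed.

HB.instance Definition _ :=
  Lmodule_isNormed.Build R Xspace ler_XnormD XnormZ Xnorm_eq0.

Definition unitseq (n : nat) : nat -> R := fun i => (i == n)%:R.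

Lemma unitseq_in n : unitseq n \in Xpred.
Proof.
rewrite !inE; apply: (@Xset_eventually0 _ _ _ n.+1) => i ni.
by rewrite /unitseq gtn_eqF.
Qed.

Definition unitvec (n : nat) : Xspace := XSpace (unitseq_in n).

End Xspace.

Section Dual.
Context (R : realType) (F : hcfamily).
Implicit Type phi : {linear Xspace R F -> R^o}.

Definition dual_seq phi : nat -> R := fun n => phi (unitvec R F n).

Definition dual_norm phi : \bar R :=
  ereal_sup [set (`|phi x|)%:E | x in [set x : Xspace R F | `|x| <= 1]].

End Dual.

(* F is the geometric dual of H: Y_F = X_H^* with equal norms, where X_H^*    *)
(* is embedded in R^N by phi |-> (phi e_n)_n.                                 *)
Definition geometric_dual (R : realType) (F H : hcfamily) : Prop :=
  Yset F = [set dual_seq phi |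
             phi in [set phi : {linear Xspace R H -> R^o} | continuous phi]] /\
  forall phi : {linear Xspace R H -> R^o}, continuous phi ->
    fnorm F (dual_seq phi) = dual_norm phi.

Definition geometrically_dual (R : realType) (F H : hcfamily) : Prop :=
  geometric_dual R F H /\ geometric_dual R H F.

Record ngraph := NGraph {
  adj : rel nat;
  adj_sym : symmetric adj;
  adj_irr : irreflexive adj }.

Section Graph.
Variable G : ngraph.
Implicit Types A H : {fset nat}.

Definition clique A : bool :=
  [forall i : A, forall j : A, (i != j) ==> adj G (val i) (val j)].

Definition anticlique A : bool :=
  [forall i : A, forall j : A, (i != j) ==> ~~ adj G (val i) (val j)].

Definition colorable H (k : nat) : bool :=
  [exists c : {ffun H -> 'I_k},
     [forall i : H, forall j : H, adj G (val i) (val j) ==> (c i != c j)]].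

Lemma colorable_card H : exists k, colorable H k.
Proof.
exists #|{: H}|; apply/existsP; exists [ffun i => enum_rank i].
apply/forallP => i; apply/forallP => j; apply/implyP => ij; rewrite !ffunE.
by apply: contraTneq ij => /enum_rank_inj ->; rewrite adj_irr.
Qed.

(* The two invariants below are those of the subgraph of G induced on H.      *)
Definition chromatic_number H : nat := ex_minn (colorable_card H).

Definition clique_number H : nat :=
  \max_(A <- fpowerset H | clique A) #|` A|.

Definition perfect : Prop :=
  forall H, chromatic_number H = clique_number H.

End Graph.

(* Main.v *)
(* Both sides are equivalent to two finitary conditions: a member of F0 and a
   member of F1 share at most one vertex, and
     sum_D |a| |x| <= ||a||_F0 ||x||_F1   for every finite D   (the pairing).
   Since finitely supported vectors are dense in X, these conditions amount to
   geometric duality, the norm of a functional being attained at sign vectors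
   supported on members of the family.
   If G is perfect, integer weights a whose cliques weigh at most n are covered
   by n anticliques, which gives the pairing for integer weights and, by
   rescaling, for real ones. Conversely the pairing forces F0 and F1 to be the
   families of cliques and anticliques of the graph of the pairs in F0, and an
   anticlique meeting all the maximum cliques of a finite H always exists:
   removing such anticliques one after the other colours H optimally. *)
Require Import Defs.
From HB Require Import structures.
From mathcomp Require Import all_boot all_order all_algebra finmap.
From mathcomp Require Import all_classical all_reals all_analysis.
From mathcomp Require Import zify.

Set Implicit Arguments.
Unset Strict Implicit.
Unset Printing Implicit Defensive.

Import Order.TTheory GRing.Theory Num.Theory.
Import numFieldNormedType.Exports.

Local Open Scope classical_set_scope.

(** * Cliques, anticliques and colourings of finite vertex sets *)

Section GraphTheory.
Variable G : ngraph.
Implicit Types A B H K S : {fset nat}.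

Lemma cliqueP A :
  reflect {in A &, forall i j, i != j -> adj G i j} (clique G A).
Proof.
apply: (iffP forallP) => [cA i j iA jA ij|cA i].
  by have /forallP/(_ [` jA]%fset)/implyP := cA [` iA]%fset; apply.
by apply/forallP => j; apply/implyP => ij; apply: cA => //; exact: valP.
Qed.

Lemma anticliqueP A :
  reflect {in A &, forall i j, ~~ adj G i j} (anticlique G A).
Proof.
apply: (iffP forallP) => [cA i j iA jA|cA i].
  have [->|ij] := eqVneq i j; first by rewrite adj_irr.
  by have /forallP/(_ [` jA]%fset)/implyP := cA [` iA]%fset; apply.
by apply/forallP => j; apply/implyP => ij; apply: cA; exact: valP.
Qed.

Lemma clique_sub A B : (A `<=` B)%fset -> clique G B -> clique G A.
Proof.
move=> /fsubsetP AB /cliqueP cB; apply/cliqueP => i j iA jA.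
by apply: cB; exact: AB.
Qed.

Lemma anticlique_sub A B : (A `<=` B)%fset -> anticlique G B -> anticlique G A.
Proof.
move=> /fsubsetP AB /anticliqueP cB; apply/anticliqueP => i j iA jA.
by apply: cB; exact: AB.
Qed.

Lemma clique1 v : clique G [fset v]%fset.
Proof. by apply/cliqueP => i j; rewrite !inE => /eqP-> /eqP->; rewrite eqxx. Qed.

Lemma clique_anticlique_meet A B :
  clique G A -> anticlique G B -> #|` A `&` B|%fset <= 1.
Proof.
move=> /cliqueP cA /anticliqueP aB; rewrite leqNgt; apply/negP => AB.
have /fset0Pn [i iAB] : (A `&` B)%fset != fset0 by rewrite -cardfs_gt0 ltnW.
have /fset0Pn [j] : ((A `&` B) `\ i)%fset != fset0.
  by rewrite -cardfs_gt0; move: AB; rewrite (cardfsD1 i) iAB.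
move: iAB; rewrite !inE => /andP[iA iB] /and3P[ji jA jB].
by have := cA _ _ jA iA ji; rewrite (negbTE (aB _ _ jB iB)).
Qed.

(** Colourings as total functions on [nat], free of the subtypes [H] and ['I_k]; vertices outside
    [H] get the default colour 0. *)
Lemma colorableP H k :
  reflect (exists c : nat -> nat, {in H, forall i, c i < k} /\
             {in H &, forall i j, adj G i j -> c i != c j})
          (colorable G H k).
Proof.
apply: (iffP existsP) => [[c /forallP cP]|[c [ck cP]]].
  exists (fun i => if insub i is Some u then val (c u) else 0); split.
    by move=> i iH; rewrite insubT; exact: ltn_ord.
  move=> i j iH jH ij; rewrite !insubT/= val_eqE.
  exact: (implyP (forallP (cP [` iH]%fset) [` jH]%fset)).
exists [ffun i : H => Ordinal (ck (val i) (valP i))].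
apply/forallP => i; apply/forallP => j; apply/implyP => ij; rewrite !ffunE.
by rewrite -val_eqE/=; apply: cP => //; exact: valP.
Qed.

Lemma leq_clique_number H A :
  clique G A -> (A `<=` H)%fset -> #|` A| <= clique_number G H.
Proof.
move=> cA AH; rewrite /clique_number.
by apply: (leq_bigmax_seq (F := fun A => #|` A|)) => //; rewrite fpowersetE.
Qed.

Lemma clique_number_leq H n :
  (forall A, clique G A -> (A `<=` H)%fset -> #|` A| <= n) ->
  clique_number G H <= n.
Proof.
by move=> Hn; apply/bigmax_leqP_seq => A; rewrite fpowersetE => AH cA; apply: Hn.
Qed.

(** A proper colouring is injective on a clique, so the colours of [A] are distinct numbers below
    [k]. *)
Lemma card_clique_colorable H A k :
  colorable G H k -> clique G A -> (A `<=` H)%fset -> #|` A| <= k.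
Proof.
move=> /colorableP[c [ck cP]] /cliqueP cA /fsubsetP AH.
rewrite -[#|` A|](size_map c) -[k](size_iota 0); apply: uniq_leq_size.
  rewrite map_inj_in_uniq ?fset_uniq// => i j iA jA cij.
  have [//|ij] := eqVneq i j.
  by have := cP _ _ (AH _ iA) (AH _ jA) (cA _ _ iA jA ij); rewrite cij eqxx.
by move=> _ /mapP[i /AH iH ->]; rewrite mem_iota /= add0n ck.
Qed.

Lemma chromatic_colorable H : colorable G H (chromatic_number G H).
Proof. by rewrite /chromatic_number; case: ex_minnP. Qed.

Lemma chromatic_leq H k : colorable G H k -> chromatic_number G H <= k.
Proof. by rewrite /chromatic_number; case: ex_minnP => m _; apply. Qed.

Lemma clique_number_leq_chromatic H :
  clique_number G H <= chromatic_number G H.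
Proof.
apply: clique_number_leq => A.
by apply: card_clique_colorable; exact: chromatic_colorable.
Qed.

(** * Covering integer weights by anticliques in a perfect graph *)

Lemma card_fsetI_sum A B : #|` (A `&` B)%fset| = \sum_(i <- A) (i \in B).
Proof.
rewrite [RHS](eq_bigr (fun i => if i \in B then 1 else 0)); last first.
  by move=> i _; case: ifP.
rewrite -big_mkcond/= big_fset_condE card_fset_sum1.
by apply: eq_fbig => // i; rewrite !inE.
Qed.

(* Lovasz' replication argument, with weights in place of replicated vertices. *)
Lemma perfect_weighted_cover (a : nat -> nat) H n : perfect G ->
  (forall v, v \notin H -> a v = 0) ->
  (forall A, clique G A -> \sum_(v <- A) a v <= n) ->
  exists ss : seq {fset nat}, [/\ all (anticlique G) ss, size ss <= n
    & forall v, a v <= count (fun S => v \in S) ss].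
Proof.
(* Induction on the total weight of [H], with [n] free because it drops by one when an anticlique is
   split off. *)
move=> Gperf; have [m] := ubnP (\sum_(v <- H) a v).
elim: m a n => // m IH a n; rewrite ltnS => am aH an.
have [/hasP[v vH /= av]|aH1] := boolP (has (fun v => 1 < a v) H); last first.
  (* All weights are at most 1, so [a] is the indicator of [H']. Its cliques have at most [n]
     vertices, and the classes of an optimal colouring of [H'] form the cover. *)
  pose H' := [fset v in H | 0 < a v]%fset.
  have omH' : chromatic_number G H' <= n.
    rewrite Gperf; apply: clique_number_leq => A cA /fsubsetP AH'.
    apply: leq_trans (an _ cA); rewrite card_fset_sum1 big_seq [leqRHS]big_seq.
    by apply: leq_sum => i /AH'; rewrite !inE => /andP[].
  have /colorableP[c [ck cP]] := chromatic_colorable H'.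
  exists [seq [fset v in H' | c v == k]%fset | k <- iota 0 (chromatic_number G H')].
  split.
  - apply/allP => _ /mapP[k _ ->]; apply/anticliqueP => i j.
    rewrite !(inE, in_fset) /= => /andP[iH' /eqP ci] /andP[jH' /eqP cj].
    apply/negP => ij; have := cP i j; rewrite !inE => /(_ iH' jH' ij).
    by rewrite ci cj eqxx.
  - by rewrite size_map size_iota.
  - move=> v; case: (posnP (a v)) => [->//|av].
    have vH : v \in H by apply: contraLR av => /aH ->.
    have vH' : v \in H' by rewrite !inE vH.
    have -> : a v = 1.
      by apply/eqP; rewrite eqn_leq av andbT leqNgt; exact: (hasPn aH1).
    rewrite -has_count; apply/hasP.
    exists [fset u in H' | c u == c v]%fset; last by rewrite !inE vH av eqxx.
    by apply/mapP; exists (c v); rewrite // mem_iota add0n/= ck.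
(* Lowering a weight [a v > 1] by one leaves it positive, so the cover of [b] given by induction
   contains an anticlique [S] through [v]. The aim is to put [S] into the cover of [a]. *)
pose b u := a u - (u == v).
have ba u : b u <= a u by exact: leq_subr.
have bm : \sum_(u <- H) b u < m.
  apply: leq_trans am; rewrite (big_fsetD1 v)//= [ltnRHS](big_fsetD1 v)//=.
  rewrite /b eqxx -addSn subn1 prednK ?(ltnW av)// leq_add2l.
  by apply: leq_sum => i _; exact: leq_subr.
have bH u : u \notin H -> b u = 0 by move=> /aH au; rewrite /b au.
have bn A : clique G A -> \sum_(u <- A) b u <= n.
  by move=> cA; apply: leq_trans (an _ cA); apply: leq_sum.
have [ss [/allP ssG ssn ssb]] := IH b n bm bH bn.
have /hasP[S Sss vS] : has (fun S => v \in S) ss.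
  by rewrite has_count; apply: leq_trans (ssb v); rewrite /b eqxx; lia.
have n0 : 0 < n.
  by have := an _ (clique1 v); rewrite big_seq_fset1; lia.
pose c u := a u - (u \in S).
have ca u : c u <= a u by exact: leq_subr.
have cm : \sum_(u <- H) c u < m.
  apply: leq_trans am; rewrite (big_fsetD1 v)//= [ltnRHS](big_fsetD1 v)//=.
  rewrite /c vS -addSn subn1 prednK ?(ltnW av)// leq_add2l.
  by apply: leq_sum => i _; exact: leq_subr.
have cH u : u \notin H -> c u = 0 by move=> /aH au; rewrite /c au.
(* A clique [A] that misses [S] misses [v], so [a] and [b] agree on it. Its weight is then at most
   the number of incidences with [ss], where [S] contributes none and every other member at most
   one. *)
have cn_disj A : clique G A -> {in A, forall u, u \notin S} ->
    \sum_(u <- A) c u <= n.-1.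
  move=> cA AS; apply: (@leq_trans (\sum_(u <- A) count (fun S => u \in S) ss)).
    rewrite big_seq [leqRHS]big_seq; apply: leq_sum => u uA.
    apply: leq_trans (ssb u); rewrite /c /b (negbTE (AS _ uA)) subn0.
    have [uv|] := eqVneq u v; last by rewrite subn0.
    by have := AS _ uA; rewrite uv vS.
  under eq_bigr do rewrite -sumn_count sumnE big_map.
  rewrite exchange_big/= (perm_big _ (perm_to_rem Sss)) big_cons.
  rewrite -card_fsetI_sum (_ : _ `&` _ = fset0)%fset ?cardfs0 ?add0n; last first.
    apply/fsetP => u; rewrite !inE; apply/negP => /andP[/AS uS].
    by rewrite (negbTE uS).
  apply: (@leq_trans (size (rem S ss))); last first.
    by rewrite size_rem// -!subn1 leq_sub2r.
  rewrite -sum1_size big_seq [leqRHS]big_seq; apply: leq_sum => T /mem_rem Tss.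
  by rewrite -card_fsetI_sum clique_anticlique_meet// ssG.
have cn A : clique G A -> \sum_(u <- A) c u <= n.-1.
  move=> cA.
  have [AS|[w]] := fset_0Vmem (A `&` S)%fset.
    apply: cn_disj => // u uA; apply/negP => uS.
    by have := in_fset0 u; rewrite -AS inE uA uS.
  rewrite inE => /andP[wA wS].
  (* If [a w = 0], truncated subtraction gains nothing at [w]; but [w] is the only vertex of [A] in
     [S], so the disjoint case applies to the rest of [A]. If [a w > 0], the weight drops by at
     least one at [w]. *)
  have [aw|aw] := posnP (a w).
    rewrite (big_fsetD1 w)//= {1}/c aw sub0n add0n; apply: cn_disj.
      by apply: clique_sub cA; exact: fsubD1set.
    move=> u; rewrite !inE => /andP[uw uA]; apply/negP => uS.
    have := clique_anticlique_meet cA (ssG _ Sss); rewrite leqNgt => /negP; apply.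
    rewrite (cardfsD1 w) inE wA wS add1n ltnS cardfs_gt0; apply/fset0Pn.
    by exists u; rewrite !inE uw uA.
  rewrite -ltnS prednK//; apply: leq_trans (an _ cA).
  rewrite (big_fsetD1 w)//= [ltnRHS](big_fsetD1 w)//=.
  rewrite /c wS -addSn subn1 prednK// leq_add2l.
  by apply: leq_sum => i _; exact: leq_subr.
have [ss' [ss'G ss'n ss'c]] := IH c n.-1 cm cH cn.
exists (S :: ss'); split => /=.
- by rewrite ss'G ssG.
- by rewrite -(prednK n0) ltnS.
- by move=> u; have := ss'c u; rewrite /c leq_subLR.
Qed.

(** * Perfection of a graph from the pairing of its cliques and anticliques *)

Hypothesis G_pairing : forall (a x : nat -> nat) H n m,
  (forall A, clique G A -> \sum_(v <- A) a v <= n) ->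
  (forall B, anticlique G B -> \sum_(v <- B) x v <= m) ->
  \sum_(v <- H) a v * x v <= n * m.

Lemma anticlique_transversal H n :
  (forall A, clique G A -> (A `<=` H)%fset -> #|` A| <= n.+1) ->
  exists S, [/\ anticlique G S, (S `<=` H)%fset & forall A, clique G A ->
    (A `<=` H)%fset -> #|` A| = n.+1 -> (A `&` S)%fset != fset0].
Proof.
move=> Hn; apply: contrapT => noS.
(* A clique K S of maximum size missing S, for each anticlique S: the sum x of
   the indicators of the K S and the indicator of H contradict the pairing. *)
have /choice[K KP] : forall S, exists A, anticlique G S -> (S `<=` H)%fset ->
    [/\ clique G A, (A `<=` H)%fset, #|` A| = n.+1 & (A `&` S)%fset = fset0].
  move=> S; apply: contrapT => noA; apply: noS; exists S.
  have [aS|aS] := boolP (anticlique G S); last first.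
    by exfalso; apply: noA; exists fset0; rewrite (negbTE aS).
  have [SH|SH] := boolP (S `<=` H)%fset; last first.
    by exfalso; apply: noA; exists fset0 => _; rewrite (negbTE SH).
  split=> // A cA AH An; apply/negP => /eqP AS; apply: noA; by exists A.
pose P S := anticlique G S.
pose x v := \sum_(S <- fpowerset H | P S) (v \in K S).
pose N := \sum_(S <- fpowerset H | P S) 1.
have hA A : clique G A -> \sum_(v <- A) (v \in H) <= n.+1.
  move=> cA; rewrite -card_fsetI_sum; apply: Hn; last exact: fsubsetIr.
  by apply: clique_sub cA; exact: fsubsetIl.
(* Among the [N] cliques, the one chosen for the anticlique [B] intersected with [H] avoids [B];
   each of the others meets [B] at most once. *)
have hB B : anticlique G B -> \sum_(v <- B) x v <= N.-1.
  move=> aB; have BH : (B `&` H)%fset \in fpowerset H.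
    by rewrite fpowersetE fsubsetIr.
  have PB : P (B `&` H)%fset by apply: anticlique_sub aB; exact: fsubsetIl.
  have [_ KH _ KB] := KP _ PB (fsubsetIr _ _).
  rewrite exchange_big/= /N (big_fset_condE _ _ P) [in leqRHS](big_fset_condE _ _ P)/=.
  have BHP : (B `&` H)%fset \in [fset S in fpowerset H | P S]%fset.
    by rewrite !(inE, in_fset)/= PB andbT.
  rewrite (big_fsetD1 _ BHP)/= [in leqRHS](big_fsetD1 _ BHP)/=.
  rewrite -card_fsetI_sum (_ : _ `&` _ = fset0)%fset; last first.
    apply/fsetP => u; rewrite !inE; apply/negP => /andP[uB uK].
    have := in_fset0 u; rewrite -KB !inE uK uB/=.
    by rewrite (fsubsetP KH).
  rewrite cardfs0 add0n/= big_seq [leqRHS]big_seq; apply: leq_sum => S.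
  rewrite !(inE, in_fset)/= => /andP[_ /andP[SH aS]].
  have {}SH : (S `<=` H)%fset by rewrite -fpowersetE.
  rewrite -card_fsetI_sum.
  rewrite fsetIC; apply: clique_anticlique_meet => //.
  by have [] := KP _ aS SH.
have := G_pairing H hA hB; apply/negP; rewrite -ltnNge.
(* Every [K S] lies in [H] and is counted in full, which exceeds the bound [n.+1 * N.-1]. *)
have -> : \sum_(v <- H) (v \in H) * x v = n.+1 * N.
  transitivity (\sum_(v <- H) x v).
    by rewrite big_seq [RHS]big_seq; apply: eq_bigr => v ->; rewrite mul1n.
  rewrite exchange_big/= /N big_distrr/= big_seq_cond [RHS]big_seq_cond.
  apply: eq_bigr => S; rewrite fpowersetE => /andP[SH aS].
  have [_ KH KS _] := KP _ aS SH.
  by rewrite -card_fsetI_sum (fsetIidPr KH) KS muln1.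
rewrite ltn_pmul2l// prednK// /N.
(* The empty anticlique makes [N] positive, so [N.-1 < N]. *)
have P0 : fset0 \in [fset S in fpowerset H | P S]%fset.
  rewrite !(inE, in_fset) -[_ && _]/((fset0 \in fpowerset H) && P fset0).
  by rewrite fpowersetE fsub0set; apply/anticliqueP.
by rewrite (big_fset_condE _ _ P) (big_fsetD1 _ P0).
Qed.

(** Induction on [n]: an anticlique meeting all cliques of size [n.+1] takes the new colour [n], and
    the cliques in the rest of [H] have at most [n] vertices. *)
Lemma colorable_pairing H n :
  (forall A, clique G A -> (A `<=` H)%fset -> #|` A| <= n) -> colorable G H n.
Proof.
elim: n H => [|n IH] H Hn.
  have H0 v : v \notin H.
    apply/negP => vH; have := Hn _ (clique1 v).
    by rewrite fsub1set vH cardfs1 => /(_ isT).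
  by apply/colorableP; exists id; split=> [i|i j]; rewrite (negbTE (H0 i)).
have [S [aS SH Sn]] := anticlique_transversal Hn.
have /IH/colorableP[c [cn cP]] A : clique G A -> (A `<=` H `\` S)%fset ->
    #|` A| <= n.
  rewrite fsubsetD => cA /andP[AH AS].
  have := Hn _ cA AH; rewrite leq_eqVlt => /orP[/eqP An|]; last by [].
  by have := Sn _ cA AH An; rewrite -fsetI_eq0 in AS *; rewrite AS.
apply/colorableP; exists (fun v => if v \in S then n else c v); split.
  move=> i iH; case: ifPn => // iS; rewrite ltnS ltnW// cn//.
  by rewrite !inE iS iH.
move=> i j iH jH ij; case: ifPn => iS; case: ifPn => jS.
- by move: ij; rewrite (negbTE (elimT (anticliqueP S) aS i j iS jS)).
- by rewrite gtn_eqF// cn// !inE jS.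
- by rewrite ltn_eqF// cn// !inE iS.
- by apply: cP => //; rewrite !inE ?iS ?jS.
Qed.

Lemma pairing_perfect_graph : perfect G.
Proof.
move=> H; apply/eqP; rewrite eqn_leq clique_number_leq_chromatic andbT.
apply: chromatic_leq; apply: colorable_pairing => A; exact: leq_clique_number.
Qed.

End GraphTheory.
Local Open Scope ring_scope.

(** * Finitely supported vectors and their density *)

Section FiniteSupport.
Context {R : realType}.
Implicit Types (F H : hcfamily) (a x y : nat -> R) (A B D : {fset nat}).

Lemma hcfam0 F : hcfam F fset0.
Proof.
by have [A FA _] := hcfam_cover F 0; apply: hcfam_hereditary FA; exact: fsub0set.
Qed.

Definition fin_restr x D : nat -> R := fun i => if i \in D then x i else 0.

Lemma fin_restr_in H x D : fin_restr x D \in Xpred H.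
Proof.
rewrite !inE; apply: (@Xset_eventually0 _ _ _ (\max_(i <- D) i).+1) => i Di.
rewrite /fin_restr; case: ifPn => // iD; move: Di; rewrite ltnNge.
by rewrite (leq_bigmax_seq (F := id)).
Qed.

Definition finvec H x D : Xspace R H := XSpace (fin_restr_in H x D).

Lemma Xval_sum H (I : Type) (r : seq I) (f : I -> Xspace R H) :
  Xval (\sum_(i <- r) f i) = \sum_(i <- r) Xval (f i).
Proof. exact: (raddf_sum (\val : Xspace R H -> (nat -> R))). Qed.

Lemma finvecE H x D : finvec H x D = \sum_(i <- D) x i *: unitvec R H i.
Proof.
apply: Xval_inj; rewrite Xval_sum fct_sumE; apply/funext => j /=.
rewrite /fin_restr; case: ifPn => jD.
  rewrite (big_fsetD1 j)//= big_seq big1 ?addr0 => [|i].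
    by rewrite fctE /unitseq eqxx scaler1.
  by rewrite !inE => /andP[ij _]; rewrite fctE /unitseq eq_sym (negbTE ij) scaler0.
rewrite big_seq big1// => i iD; rewrite fctE /unitseq.
by case: eqVneq iD jD => [->->//|_ _ _]; rewrite scaler0.
Qed.

(** By heredity, the trace on [D] of a member of [F] is again a member, with the same sum. *)
Lemma fnorm_fin_restr_le F x D s :
  (forall A, hcfam F A -> (A `<=` D)%fset -> \sum_(i <- A) `|x i| <= s) ->
  (fnorm F (fin_restr x D) <= s%:E)%E.
Proof.
move=> xs; apply: fnorm_le => A FA; rewrite lee_fin.
have FAD : hcfam F (A `&` D)%fset.
  by apply: hcfam_hereditary FA; exact: fsubsetIl.
apply: le_trans (xs _ FAD (fsubsetIr _ _)); rewrite le_eqVlt; apply/orP; left.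
apply/eqP; rewrite -(big_fset_incl _ (fsubsetIl A D))/= => [|i iA].
  rewrite big_seq [RHS]big_seq; apply: eq_bigr => i.
  by rewrite inE /fin_restr => /andP[_ ->].
by rewrite inE iA/= /fin_restr => /negbTE->; rewrite normr0.
Qed.

Lemma norm_finvec_le H x D t :
  (forall B, hcfam H B -> (B `<=` D)%fset -> \sum_(i <- B) `|x i| <= t) ->
  `|finvec H x D| <= t.
Proof. by move=> xt; rewrite -lee_fin XnormE fnorm_fin_restr_le. Qed.

Lemma sum_Xval_le H (x : Xspace R H) B : hcfam H B ->
  \sum_(i <- B) `|Xval x i| <= `|x|.
Proof. by move=> HB; rewrite -lee_fin XnormE fnorm_ub. Qed.

Definition initial n : {fset nat} := [fset i in iota 0 n]%fset.

Lemma in_initial n i : (i \in initial n) = (i < n)%N.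
Proof. by rewrite in_fset /= mem_iota. Qed.

Lemma sum_initial n (f : nat -> R) : \sum_(i <- initial n) f i = series f n.
Proof.
rewrite /series/= /index_iota subn0; apply: perm_big.
apply: uniq_perm; [exact: fset_uniq|exact: iota_uniq|] => i.
by rewrite in_initial mem_iota.
Qed.

(** The difference of [x] and its truncation at [n] is the tail whose norm tends to 0 by the
    definition of [Xset]. *)
Lemma cvg_finvec_initial H (x : Xspace R H) :
  finvec H (Xval x) (initial n) @[n --> \oo] --> x.
Proof.
apply/cvgrPdist_lt => e e0.
have Xx : Xset H (Xval x) by have := Xval_in x; rewrite !inE.
have [N _ hN] : \forall n \near \oo,
    (fnorm H (Xval x \_ [set i | (n <= i)%N]) < e%:E)%E.
  by apply: (Xx _ (open_ereal_lt' _)); rewrite lte_fin.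
exists N => // n /hN /=; rewrite -lte_fin XnormE.
congr (fnorm H _ < _)%E; apply/funext => i; rewrite restrictE.
rewrite [RHS](_ : _ = Xval x i - fin_restr (Xval x) (initial n) i)//.
rewrite /fin_restr in_initial ltnNge.
by case: leqP => _ /=; rewrite ?subr0 ?subrr.
Qed.

End FiniteSupport.

(** * Continuous functionals on the space of a family *)

Section Functional.
Context {R : realType} {H : hcfamily}.
Variable phi : {linear Xspace R H -> R^o}.
Implicit Types (a x y : nat -> R) (A B D : {fset nat}).

Lemma functional_finvec x D :
  phi (finvec H x D) = \sum_(i <- D) x i * dual_seq phi i.
Proof.
by rewrite finvecE linear_sum; apply: eq_bigr => i _; rewrite linearZ.
Qed.

Hypothesis phi_cont : continuous phi.

(** Continuity and density: a bound on the values at all finite truncations of [x] passes to the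
    limit. *)
Lemma functional_le (x : Xspace R H) c :
  (forall D, `|phi (finvec H (Xval x) D)| <= c) -> `|phi x| <= c.
Proof.
move=> hc.
have cvx : `|phi (finvec H (Xval x) (initial n))| @[n --> \oo] --> `|phi x|.
  apply: cvg_norm.
  exact: (cvg_comp _ _ (@cvg_finvec_initial R H x) (@phi_cont x)).
rewrite -(cvg_lim _ cvx)//; apply: limr_le; first by apply/cvg_ex; eexists; exact: cvx.
by apply: nearW => n; exact: hc.
Qed.

Lemma functional_le_dual_norm (s : R) (x : Xspace R H) :
  (dual_norm phi <= s%:E)%E -> `|phi x| <= s * `|x|.
Proof.
move=> phis; have [->|x0] := eqVneq x 0; first by rewrite linear0 !normr0 mulr0.
have nx : 0 < `|x| by rewrite normr_gt0.
rewrite -ler_pdivrMr// mulrC -{1}[ `|x| ]normr_id -normfV -normrM -linearZ.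
rewrite -lee_fin; apply: le_trans phis; apply: ereal_sup_ubound => /=.
exists (`|x|^-1 *: x) => //=; rewrite normrZ normfV normr_id mulVf//.
by rewrite gt_eqF.
Qed.

Lemma dual_norm_le (s : R) :
  (forall x : Xspace R H, `|x| <= 1 -> `|phi x| <= s) ->
  (dual_norm phi <= s%:E)%E.
Proof. by move=> h; apply: ge_ereal_sup => _ [x /= x1 <-]; rewrite lee_fin h. Qed.

End Functional.

(** * Geometric duality and the pairing *)

Section Pairing.
Context {R : realType}.
Implicit Types (F H : hcfamily) (a x y : nat -> R) (A B D : {fset nat}).

(** A Holder inequality between the two norms. Real upper bounds [s] and [t] replace the norms,
    which are extended reals. *)
Definition pairing F H := forall a x D (s t : R),
  (forall A, hcfam F A -> \sum_(i <- A) `|a i| <= s) ->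
  (forall B, hcfam H B -> \sum_(i <- B) `|x i| <= t) ->
  \sum_(i <- D) `|a i| * `|x i| <= s * t.

Lemma pairingC F H : pairing F H -> pairing H F.
Proof.
move=> FH a x D s t sa tx; rewrite mulrC; apply: le_trans (FH x a D t s tx sa).
by rewrite le_eqVlt; apply/orP; left; apply/eqP/eq_bigr => i _; rewrite mulrC.
Qed.

Definition meet_le1 F H :=
  forall A B, hcfam F A -> hcfam H B -> (#|` A `&` B|%fset <= 1)%N.

Lemma meet_le1C F H : meet_le1 F H -> meet_le1 H F.
Proof. by move=> FH A B HA FB; rewrite fsetIC; exact: FH. Qed.

(** The restriction of [a] to [D] is a functional of norm at most [s]. Its value at [x] on [D], with
    the signs adjusted to those of [a], is the sum to be bounded. *)
Lemma geometric_dual_pairing F H : geometric_dual R F H -> pairing F H.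
Proof.
move=> [YX normE] a x D s t sa tx.
have s0 : 0 <= s by have := sa _ (hcfam0 F); rewrite big_seq_fset0.
have Fa : (fnorm F (fin_restr a D) <= s%:E)%E.
  by apply: fnorm_fin_restr_le => A FA _; exact: sa.
have : Yset F (fin_restr a D) by apply: le_lt_trans Fa _; rewrite ltry.
rewrite YX => -[phi /= phi_cont phiE].
have phis : (dual_norm phi <= s%:E)%E by rewrite -normE// phiE.
pose u := finvec H (fun i => Num.sg (a i) * `|x i|) D.
have u_le : `|u| <= t.
  apply: norm_finvec_le => B HB _; apply: le_trans (tx _ HB).
  apply: ler_sum => i _; rewrite normrM normr_id normr_sg.
  by case: (a i != 0) => /=; rewrite ?mul1r ?mul0r.
have phiu : phi u = \sum_(i <- D) `|a i| * `|x i|.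
  rewrite functional_finvec phiE big_seq [RHS]big_seq; apply: eq_bigr => i iD.
  by rewrite /fin_restr iD mulrAC -normrEsg.
rewrite -phiu; apply: le_trans (ler_norm _) _.
apply: le_trans (functional_le_dual_norm _ phis) _.
exact: ler_wpM2l.
Qed.

(** The indicator of [D], the intersection of [A] and [B], has norm at least the size of [D] since
    [D] is in [F]. As a functional it has norm at most 1, since [D] is in [H]. *)
Lemma geometric_dual_meet_le1 F H : geometric_dual R F H -> meet_le1 F H.
Proof.
move=> [YX normE] A B FA HB; pose D := (A `&` B)%fset.
have HD : hcfam H D by apply: hcfam_hereditary HB; exact: fsubsetIr.
have FD : hcfam F D by apply: hcfam_hereditary FA; exact: fsubsetIl.
have card_sum (E : {fset nat}) : \sum_(i <- E) `|(cst 1 : nat -> R) i| = #|` E|%:R.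
  by rewrite card_fset_sum1 natr_sum; apply: eq_bigr => i _; rewrite normr1.
pose y : nat -> R := fin_restr (cst 1) D.
have : Yset F y.
  apply: (@le_lt_trans _ _ (#|` D|%:R%:E)); last by rewrite ltry.
  apply: fnorm_fin_restr_le => E _ ED; rewrite card_sum ler_nat.
  exact: fsubset_leq_card.
rewrite YX => -[phi /= phi_cont phiE].
rewrite -(ler_nat R) -lee_fin.
apply: (@le_trans _ _ (fnorm F y)).
  apply: le_trans (fnorm_ub _ FD); rewrite lee_fin -card_sum.
  rewrite big_seq [leRHS]big_seq; apply: ler_sum => i iD.
  by rewrite /y /fin_restr iD.
rewrite -phiE normE//; apply: dual_norm_le => x x1.
apply: (functional_le phi_cont) => E; rewrite functional_finvec phiE.
apply: le_trans (ler_norm_sum _ _ _) _.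
have HDE : hcfam H (E `&` D)%fset.
  by apply: hcfam_hereditary HD; exact: fsubsetIr.
apply: le_trans x1; apply: le_trans (sum_Xval_le x HDE).
rewrite -(big_fset_incl _ (fsubsetIl E D))/= => [|i iE].
  rewrite big_seq [leRHS]big_seq; apply: ler_sum => i; rewrite inE => /andP[_ iD].
  by rewrite /y /fin_restr iD mulr1.
by rewrite inE iE/= /y /fin_restr => /negbTE->; rewrite mulr0 normr0.
Qed.

(** The witness is the sign vector of [phi] on [A]: a member of [H] inside [A] has at most one
    element, so its norm is at most 1. *)
Lemma dual_attained F H (phi : {linear Xspace R H -> R^o}) A :
  meet_le1 F H -> hcfam F A ->
  exists2 u, `|u| <= 1 & phi u = \sum_(i <- A) `|dual_seq phi i|.
Proof.
move=> FH FA; exists (finvec H (fun i => Num.sg (dual_seq phi i)) A).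
  apply: norm_finvec_le => B HB BA.
  apply: (@le_trans _ _ #|` B|%:R).
    rewrite card_fset_sum1 natr_sum; apply: ler_sum => i _.
    by rewrite normr_sg; case: (_ != _).
  rewrite lern1.
  by have := FH _ _ FA HB; rewrite (fsetIidPr BA).
by rewrite functional_finvec; apply: eq_bigr => i _; rewrite -normrEsg.
Qed.

Lemma Yset_dual_seq F H (phi : {linear Xspace R H -> R^o}) :
  meet_le1 F H -> continuous phi -> Yset F (dual_seq phi).
Proof.
move=> FH /linear_bounded_continuous/linear_boundedP/pinfty_ex_gt0[r r0 phir].
apply: (@le_lt_trans _ _ r%:E); last by rewrite ltry.
apply: fnorm_le => A FA; have [u u1 <-] := dual_attained phi FH FA.
rewrite lee_fin; apply: le_trans (ler_norm _) _; apply: le_trans (phir u) _.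
by rewrite ler_piMr// ltW.
Qed.

(** The pairing bounds the partial sums of the absolute values, so the series converges
    absolutely. *)
Lemma pairing_cvg F H y (x : Xspace R H) (s : R) : pairing F H ->
  (fnorm F y <= s%:E)%E ->
  cvgn (series (fun i => y i * Xval x i)) /\
  `|limn (series (fun i => y i * Xval x i))| <= s * `|x|.
Proof.
move=> FH ys.
have bnd n : [normed series (fun i => y i * Xval x i)] n <= s * `|x|.
  rewrite -[leLHS]/(series (fun i => `|y i * Xval x i|) n) -sum_initial.
  under eq_bigr do rewrite normrM.
  apply: FH => [A FA|B HB]; last exact: sum_Xval_le.
  by rewrite -lee_fin; apply: le_trans ys; exact: fnorm_ub.
have cv : cvgn [normed series (fun i => y i * Xval x i)].
  apply: nondecreasing_is_cvgn.
    exact: (@nondecreasing_series R (fun i => `|y i * Xval x i|) xpredT 0%N).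
  by exists (s * `|x|) => _ [n _ <-]; exact: bnd.
split; first exact: normed_cvg.
apply: le_trans (lim_series_norm cv) _; apply: limr_le => //.
by apply: nearW => n; exact: bnd.
Qed.

Lemma pairing_functional F H y : pairing F H -> Yset F y ->
  exists2 phi : {linear Xspace R H -> R^o}, continuous phi & dual_seq phi = y.
Proof.
move=> FH Yy; pose s := fine (fnorm F y).
have ys : (fnorm F y <= s%:E)%E.
  by rewrite fineK// ge0_fin_numE ?fnorm_ge0.
(* By [pairing_cvg] this limit exists for every [x], which gives linearity, and is at most [s] times
   the norm of [x], which gives continuity. *)
pose f (x : Xspace R H) : R^o := limn (series (fun i => y i * Xval x i)).
have f_lin : linear f.
  move=> c x z; rewrite /f.
  have [cx _] := pairing_cvg x FH ys; have [cz _] := pairing_cvg z FH ys.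
  apply: cvg_lim => //.
  rewrite (_ : series _ = (fun n => c * series (fun i => y i * Xval x i) n +
    series (fun i => y i * Xval z i) n)).
    by apply: cvgD => //; apply: cvgMr.
  apply/funext => n; rewrite /series/= mulr_sumr -big_split/=.
  apply: eq_bigr => i _; by rewrite [LHS]mulrDr mulrCA.
pose phi : {linear Xspace R H -> R^o} :=
  HB.pack f (GRing.isLinear.Build _ _ _ _ f f_lin).
exists phi.
  apply/linear_bounded_continuous/linear_boundedP; near=> r => x.
  have [_ /le_trans] := pairing_cvg x FH ys; apply.
  by apply: ler_wpM2r => //; near: r; exact: nbhs_pinfty_ge.
(* At the unit vector of index [n] the partial sums are constant from [n.+1] on. *)
apply/funext => n; rewrite /dual_seq/= /f; apply: lim_near_cst => //.
exists n.+1 => // m /= nm; rewrite -sum_initial.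
rewrite (big_fsetD1 n)/= ?in_initial// /unitseq eqxx mulr1 big_seq big1 ?addr0//.
by move=> i; rewrite !inE => /andP[/negbTE-> _]; rewrite mulr0.
Unshelve. all: by end_near. Qed.

Lemma pairing_geometric_dual F H :
  pairing F H -> meet_le1 F H -> geometric_dual R F H.
Proof.
move=> FH FH1; split.
  apply/seteqP; split => [y Yy|_ [phi phi_cont <-]].
    by have [phi ? ?] := pairing_functional FH Yy; exists phi.
  exact: Yset_dual_seq.
move=> phi phi_cont; apply/eqP; rewrite eq_le; apply/andP; split.
  apply: fnorm_le => A FA; have [u u1 phiu] := dual_attained phi FH1 FA.
  apply: ereal_sup_ubound => /=; exists u => //; rewrite phiu ger0_norm//.
  exact: sumr_ge0.
(* The other inequality is the pairing applied to finite truncations. *)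
have := Yset_dual_seq FH1 phi_cont.
rewrite /Yset/= -ge0_fin_numE ?fnorm_ge0// => /fineK.
set s := fine _ => sE; rewrite -sE; apply: dual_norm_le => x x1.
have s0 : 0 <= s by rewrite -lee_fin sE fnorm_ge0.
apply: (functional_le phi_cont) => D; rewrite functional_finvec.
apply: le_trans (ler_norm_sum _ _ _) _.
apply: (@le_trans _ _ (s * `|x|)); last by rewrite ler_piMr.
under eq_bigr do rewrite normrM mulrC.
apply: FH => [A FA|B HB]; last exact: sum_Xval_le.
by rewrite -lee_fin sE; exact: fnorm_ub.
Qed.

End Pairing.

(** * Perfect graphs and the pairing *)

Section Main.
Context {R : realType}.
Implicit Types (F H : hcfamily) (a x : nat -> R) (A B D : {fset nat}).

Lemma perfect_pairing F H (G : ngraph) : perfect G ->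
  hcfam F = [set A | clique G A] -> hcfam H = [set A | anticlique G A] ->
  pairing (R := R) F H.
Proof.
move=> Gperf FG HG a x D s t sa tx.
have s0 : 0 <= s by have := sa _ (hcfam0 F); rewrite big_seq_fset0.
have t0 : 0 <= t by have := tx _ (hcfam0 H); rewrite big_seq_fset0.
(* The pairing scaled by [k], with an error independent of [k]; [b] is the integer part of [k] times
   [a], taken on [D] only. *)
have approx k : k%:R * (\sum_(i <- D) `|a i| * `|x i|) <=
    k%:R * (s * t) + \sum_(i <- D) `|x i|.
  pose b i := if i \in D then Num.trunc (k%:R * `|a i|) else 0%N.
  have ka0 i : 0 <= k%:R * `|a i| by rewrite mulr_ge0.
  have bka i : (b i)%:R <= k%:R * `|a i|.
    by rewrite /b; case: ifP; rewrite ?truncn_le.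
  have [||ss [/allP ssG ssn ssb]] :=
      @perfect_weighted_cover G b D (Num.trunc (k%:R * s)) Gperf.
  - by move=> v /negbTE; rewrite /b => ->.
  - move=> A cA; rewrite truncn_ge_nat ?mulr_ge0// natr_sum.
    apply: (@le_trans _ _ (k%:R * \sum_(i <- A) `|a i|)).
      by rewrite mulr_sumr; apply: ler_sum.
    by apply: ler_wpM2l => //; apply: sa; rewrite FG.
  (* At most [k%:R * s] anticliques cover [b], and [x] sums to at most [t] on each of them. *)
  have bx : \sum_(i <- D) (b i)%:R * `|x i| <= k%:R * (s * t).
    apply: (@le_trans _ _ ((size ss)%:R * t)); last first.
      rewrite mulrA; apply: ler_wpM2r => //.
      by rewrite -truncn_ge_nat ?mulr_ge0.
    apply: (@le_trans _ _ (\sum_(i <- D) \sum_(S <- ss) (i \in S)%:R * `|x i|)).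
      apply: ler_sum => i _; rewrite -mulr_suml ler_wpM2r//.
      by rewrite -natr_sum ler_nat -(big_map _ predT id) -sumnE sumn_count.
    rewrite exchange_big/= -sum1_size natr_sum mulr_suml.
    rewrite big_seq [leRHS]big_seq; apply: ler_sum => S Sss; rewrite mul1r.
    have HS : hcfam H (D `&` S)%fset.
      by apply: hcfam_hereditary (fsubsetIr D S) _; rewrite HG; exact: ssG.
    apply: le_trans (tx _ HS).
    rewrite -(big_fset_incl _ (fsubsetIl D S))/= => [|i iD].
      rewrite big_seq [leRHS]big_seq; apply: ler_sum => i.
      by rewrite inE => /andP[_ ->]; rewrite mul1r.
    by rewrite inE iD/= => /negbTE->; rewrite mul0r.
  (* Rounding loses less than 1 at each vertex, hence at most the sum of [x] in absolute value. *)
  apply: le_trans (lerD bx (lexx _)); rewrite -big_split/= mulr_sumr.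
  rewrite big_seq [leRHS]big_seq; apply: ler_sum => i iD.
  rewrite mulrA -[X in _ + X]mul1r -mulrDl ler_wpM2r//.
  by rewrite /b iD natr1 ltW//; have /andP[] := truncn_itv (ka0 i).
(* Archimedean argument: an excess [d > 0] would give [k * d <= C] for all [k]. *)
rewrite leNgt -subr_gt0; apply/negP => d0.
set d := _ - _ in d0; set C := \sum_(i <- D) `|x i| in approx.
have := approx (Num.trunc (C / d)).+1; rewrite -lerBlDl -mulrBr -ler_pdivlMr//.
have C0 : 0 <= C by exact: sumr_ge0.
rewrite leNgt => /negP; apply.
by have /andP[] := truncn_itv (divr_ge0 C0 (ltW d0)).
Qed.

(* The pairing of the indicator of A with itself. *)
Lemma hcfam_of_pairing F H A : pairing (R := R) F H -> A != fset0 ->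
  (forall B, hcfam H B -> (#|` A `&` B|%fset <= 1)%N) -> hcfam F A.
Proof.
move=> FH A0 AH; apply: contrapT => nFA.
pose u : nat -> R := fin_restr (cst 1) A.
have uI B : \sum_(i <- B) `|u i| = #|` (B `&` A)%fset|%:R.
  rewrite card_fsetI_sum natr_sum; apply: eq_bigr => i _.
  by rewrite /u /fin_restr; case: ifP; rewrite ?normr1 ?normr0.
(* By heredity no member of [F] contains [A], so each misses a vertex of [A]. The pairing would then
   bound the size of [A] by its predecessor. *)
have uF B : hcfam F B -> \sum_(i <- B) `|u i| <= #|` A|.-1%:R.
  move=> FB; rewrite uI ler_nat -ltnS prednK ?cardfs_gt0// ltnNge.
  apply/negP => AB; apply: nFA; apply: hcfam_hereditary FB.
  by apply/fsetIidPr/eqP; rewrite eqEfcard fsubsetIr AB.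
have uH B : hcfam H B -> \sum_(i <- B) `|u i| <= 1.
  by move=> HB; rewrite uI lern1 fsetIC AH.
have := FH u u A _ _ uF uH; rewrite mulr1; apply/negP; rewrite -ltNge.
rewrite (_ : \sum_(i <- A) _ = \sum_(i <- A) `|u i|); last first.
  rewrite big_seq [RHS]big_seq; apply: eq_bigr => i iA.
  by rewrite /u /fin_restr iA normr1 mulr1.
by rewrite uI fsetIid ltr_nat ltn_predL cardfs_gt0.
Qed.

Lemma pairing_nat F H (a x : nat -> nat) D n m : pairing (R := R) F H ->
  (forall A, hcfam F A -> (\sum_(i <- A) a i <= n)%N) ->
  (forall B, hcfam H B -> (\sum_(i <- B) x i <= m)%N) ->
  (\sum_(i <- D) a i * x i <= n * m)%N.
Proof.
move=> FH an xm; rewrite -(ler_nat R) natr_sum natrM.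
under eq_bigr do rewrite natrM -[X in X * _]normr_nat -[X in _ * X]normr_nat.
apply: (FH (fun i => (a i)%:R) (fun i => (x i)%:R)) => [A FA|B HB].
  by under eq_bigr do rewrite normr_nat; rewrite -natr_sum ler_nat an.
by under eq_bigr do rewrite normr_nat; rewrite -natr_sum ler_nat xm.
Qed.

Lemma pairing_perfect F H : pairing (R := R) F H -> meet_le1 F H ->
  exists G : ngraph, [/\ perfect G, hcfam F = [set A | clique G A]
    & hcfam H = [set A | anticlique G A]].
Proof.
move=> FH FH1.
pose e i j := (i != j) && `[< hcfam F [fset i; j]%fset >].
have e_sym : symmetric e by move=> i j; rewrite /e eq_sym fsetUC.
have e_irr : irreflexive e by move=> i; rewrite /e eqxx.
pose G := NGraph e_sym e_irr.
have pairF A i j : hcfam F A -> i \in A -> j \in A -> i != j -> e i j.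
  move=> FA iA jA ij; rewrite /e ij; apply/asboolP; apply: hcfam_hereditary FA.
  by apply/fsubsetP => k; rewrite !inE => /orP[] /eqP->.
have FG A : hcfam F A -> clique G A.
  by move=> FA; apply/cliqueP => i j iA jA; exact: (pairF A).
(* An edge inside [B] would be a member of [F] sharing two vertices with [B]. *)
have HG B : hcfam H B -> anticlique G B.
  move=> HB; apply/anticliqueP => i j iB jB; apply/negP => /andP[ij /asboolP Fij].
  have := FH1 _ _ Fij HB; rewrite (fsetIidPl _) ?cardfs2 ?ij//.
  by apply/fsubsetP => k; rewrite !inE => /orP[] /eqP->.
(* Members of [H] are anticliques, so they meet [A] at most once and [hcfam_of_pairing] applies; the
   empty set is treated apart. *)
have GF A : clique G A -> hcfam F A.
  move=> cA; have [->|A0] := eqVneq A fset0; first exact: hcfam0.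
  apply: (hcfam_of_pairing FH A0) => B /HG; exact: clique_anticlique_meet cA.
have GH B : anticlique G B -> hcfam H B.
  move=> aB; have [->|B0] := eqVneq B fset0; first exact: hcfam0.
  apply: (hcfam_of_pairing (pairingC FH) B0) => A /FG cA.
  by rewrite fsetIC; exact: (clique_anticlique_meet cA).
exists G; split; [|by apply/seteqP; split => A; [exact: FG|exact: GF]
  |by apply/seteqP; split => B; [exact: HG|exact: GH]].
apply: pairing_perfect_graph => a x D n m an xm.
by apply: (pairing_nat D FH) => [A /FG|B /HG]; [exact: an|exact: xm].
Qed.

End Main.

Theorem mainTheorem1 (R : realType) (F0 F1 : hcfamily) :
  geometrically_dual R F0 F1 <->
  exists G : ngraph,
    [/\ perfect G,
        hcfam F0 = [set A | clique G A]
      & hcfam F1 = [set A | anticlique G A]].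
Proof.
split=> [[F01 _]|[G [Gperf F0G F1G]]].
  exact: pairing_perfect (geometric_dual_pairing F01)
    (geometric_dual_meet_le1 F01).
have F01 : pairing (R := R) F0 F1 by exact: perfect_pairing Gperf F0G F1G.
have F01_meet : meet_le1 F0 F1.
  by move=> A B; rewrite F0G F1G; exact: clique_anticlique_meet.
(* Both finitary conditions are symmetric in the two families. *)
split; apply: pairing_geometric_dual => //.
  exact: pairingC.
exact: meet_le1C.
Qed.
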